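(* Let $N$ have the prime decomposition $N=p_1^{n_1}\cdots p_r^{n_r}$ (distinct primes $p_i$, integers $n_i\ge 1$). Suppose that: 1. for all $i\in\{1,\dots,r\}$, there exists no NAR modulo $(p_i-1)$ on the multiset $$P\!\left(\frac{N}{p_i^{n_i}}\right)=\bigotimes_{j\ne i}\{1,(p_j-1),(p_j-1)p_j,\dots,(p_j-1)p_j^{n_j-1}\};$$ 2. there exists an $i\in\{1,\dots,r\}$ such that there exists no NAR modulo $p_i$ on the multiset $$\bigotimes_{j\ne i}\{1,p_j,\dots,p_j^{n_j-1}\}.$$ Then there exists no NAR on $P(N)$. As a consequence, $N$ satisfies the ISAP.
   Context: **ISAP.** For a positive integer $N$ and a set $D$ of divisors $d$ of $N$ with $1\le d<N$, let $ICG_N(D)$ be the graph on vertex set $\mathbb{Z}/N\mathbb{Z}$ in which $i,j$ are adjacent iff $\gcd(i-j,N)\in D$. (These are exactly the integral circulant graphs of order $N$; $D$ is the integral symbol.) The spectrum of a graph is the multiset of eigenvalues of its adjacency matrix. $N$ satisfies the integral spectral Ádám property (ISAP) if for any two such sets $D,D'$, the graphs $ICG_N(D)$ and $ICG_N(D')$ have the same spectrum if and only if $D=D'$. **NAR.** Let $v=(v[x])_{x\in S}$ be a finite family of integers with index set $S$ (multisets are viewed as indexed families, so equal values with different indices are distinguished). A nontrivial additive relation (NAR) on $v$ is a pair of subsets $S_1\neq S_2$ of $S$ (either may be empty) with $\sum_{x\in S_1}v[x]=\sum_{x\in S_2}v[x]$. A NAR modulo $m$ on $v$ is the same with equality replaced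 by congruence modulo $m$. **Products.** For multisets $S_1,\dots,S_k$, $\bigotimes_{i=1}^k S_i$ is the multiset of the $|S_1|\cdots|S_k|$ products obtained by choosing one element from each $S_i$ (indexed by the choices; the empty product is $\{1\}$). **$P(N)$.** For $N=p_1^{n_1}\cdots p_r^{n_r}$, $P(N)$ is the family $\left(\phi(p_1^{m_1}\cdots p_r^{m_r})\right)$ indexed by $(m_1,\dots,m_r)\in\{0,\dots,n_1\}\times\cdots\times\{0,\dots,n_r\}$, where $\phi$ is Euler's function. *)

(* Defs.v *)
From mathcomp Require Import all_boot all_order all_algebra all_field.
From mathcomp Require Import finmap multiset.

Set Implicit Arguments.
Unset Strict Implicit.
Unset Printing Implicit Defensive.

Import Order.TTheory GRing.Theory Num.Theory.
Local Open Scope ring_scope.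

(* Families are functions on a finType, so that equal values carried by
   different indices stay distinguished. *)

Definition has_NAR (S : finType) (v : S -> int) : Prop :=
  exists S1 S2 : {set S},
    S1 <> S2 /\ \sum_(x in S1) v x = \sum_(x in S2) v x.

Definition has_NAR_mod (m : int) (S : finType) (v : S -> int) : Prop :=
  exists S1 S2 : {set S},
    S1 <> S2 /\ (\sum_(x in S1) v x = \sum_(x in S2) v x %[mod m])%Z.

(* The product is indexed by choice functions; for empty I it is {1}. *)
Definition tensor (I : finType) (T : I -> finType) (v : forall i, T i -> int)
    (c : {dffun forall i : I, T i}) : int :=
  \prod_(i : I) v i (c i).

(* P(N) for N = \prod_(i : I) p i ^ n i, the p i being distinct primes. *)
Definition P_family (I : finType) (p n : I -> nat)
    (m : {dffun forall i : I, 'I_(n i).+1}) : int :=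
  (totient (\prod_(i : I) p i ^ m i)%N)%:Z.

Definition powers (q k : nat) (m : 'I_k) : int := (q ^ m)%N%:Z.

(* {1, q - 1, (q - 1) q, ..., (q - 1) q ^ (k - 1)} *)
Definition totient_powers (q k : nat) (m : 'I_k.+1) : int :=
  if m == 0 :> nat then 1 else (q%:Z - 1) * q%:Z ^+ m.-1.

Lemma P_family_tensor (I : finType) (p n : I -> nat) :
  injective p -> (forall i, prime (p i)) ->
  @P_family I p n =1 tensor (fun i => @totient_powers (p i) (n i)).
Proof.
move=> p_inj p_pr m; rewrite /P_family /tensor.
pose Q (r : seq I) := uniq r ->
  (totient (\prod_(i <- r) p i ^ m i)%N)%:Z
  = \prod_(i <- r) @totient_powers (p i) (n i) (m i).
suff: Q (index_enum I) by apply; exact: index_enum_uniq.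
elim: (index_enum I) => [|i r IHr]; first by rewrite /Q !big_nil.
rewrite /Q /= => /andP[iNr /IHr {}IHr]; rewrite !big_cons totient_coprime.
  rewrite PoszM IHr; congr (_ * _); rewrite /totient_powers.
  case: (val (m i)) => [|k] //=.
  rewrite totient_pfactor // PoszM -predn_int ?prime_gt0 //.
  by congr (_ * _); rewrite -[LHS]natz natrX natz.
rewrite coprimeXl // big_seq; elim/big_ind: _ => [|a b|j jr].
- exact: coprimen1.
- by rewrite coprimeMr => -> ->.
rewrite coprimeXr // prime_coprime // dvdn_prime2 //.
by apply: contra iNr => /eqP /p_inj ->.
Qed.

Definition integral_symbol (N : nat) (D : {fset nat}) : Prop :=
  forall d, d \in D -> [/\ (d %| N)%N, (1 <= d)%N & (d < N)%N].

(* Z/NZ is represented by 'I_N, the residues 0, ..., N - 1. *)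
Definition ICG (N : nat) (D : {fset nat}) : rel 'I_N :=
  fun i j => gcdn `|(i : nat)%:Z - (j : nat)%:Z|%N N \in D.

Definition adjacency (n : nat) (e : rel 'I_n) : 'M[algC]_n :=
  \matrix_(i, j) (e i j)%:R.

(* closed_field_poly_normal provides the complex roots of a polynomial,
   listed with multiplicity. *)
Definition spectrum (n : nat) (e : rel 'I_n) : {mset algC}%mset :=
  seq_mset (sval (closed_field_poly_normal (char_poly (adjacency e)))).

Definition ISAP (N : nat) : Prop :=
  forall D D' : {fset nat}, integral_symbol N D -> integral_symbol N D' ->
    spectrum (@ICG N D) = spectrum (@ICG N D') <-> D = D'.

(* Main.v *)
(* A NAR on P(N) is a vanishing combination of the phi(p_1^m_1 ... p_r^m_r) with
   coefficients in {-1, 0, 1}.  The terms with m_i > 0 are divisible by p_i - 1,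
   so hypothesis 1 kills the coefficients with m_i = 0, for every i.  After
   dividing by the product of the p_i - 1, hypothesis 2 kills the remaining ones
   by induction on m_i: modulo the next power of p_i only the terms with the
   current value of m_i survive.

   For the ISAP, ICG_N(D) is regular, its degree is the sum of the phi(N/d) for
   d in D, and the degree of a regular graph is its largest eigenvalue.  So equal
   spectra give equal subsums of P(N), hence D = D'. *)

Require Import Defs.
From mathcomp Require Import all_boot all_order all_algebra all_field.
From mathcomp Require Import finmap multiset.

Set Implicit Arguments.
Unset Strict Implicit.
Unset Printing Implicit Defensive.

Import Order.TTheory GRing.Theory Num.Theory.
Local Open Scope ring_scope.

(** * Relations as combinations with coefficients -1, 0, 1 *)

Lemma dvdz_sum (I : Type) (r : seq I) (P : pred I) (F : I -> int) (m : int) :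
  (forall i, P i -> (m %| F i)%Z) -> (m %| \sum_(i <- r | P i) F i)%Z.
Proof. by move=> mF; apply: rpred_sum => i /mF. Qed.

(** The images under [h] of the sets where [e] is 1 and where [e] is -1 have congruent sums. A
    nonzero [e x] puts [h x] in exactly one of them, which would give a NAR. The map [h] serves to
    drop a coordinate that is constant on [B]. *)
Lemma sign_coef_eq0 (m : int) (S T : finType) (v : S -> int) (h : T -> S)
    (B : {set T}) (e : T -> int) :
  ~ has_NAR_mod m v -> {in B &, injective h} ->
  {in B, forall x, e x \in [:: -1; 0; 1]} ->
  (m %| \sum_(x in B) e x * v (h x))%Z -> {in B, forall x, e x = 0}.
Proof.
move=> noNAR h_inj e_sign dvd_m x xB; apply/eqP/negP => /negP ex_neq0.
case: noNAR; pose U c := [set y in B | e y == c].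
have UB c : {subset U c <= B} by move=> y; rewrite inE => /andP[].
have hU_inj c : {in U c &, injective h} by apply: sub_in2 h_inj => y /UB.
have h_notin c c' : c != c' -> x \in U c -> h x \notin h @: U c'.
  move=> neq_c xU; apply/imsetP => -[y yU hxy].
  have eq_xy : x = y by apply: h_inj hxy; [exact: UB xU | exact: UB yU].
  move: xU yU; rewrite eq_xy.
  by rewrite !inE => /andP[_ /eqP->] /andP[_ /eqP eq_c]; rewrite eq_c eqxx in neq_c.
exists (h @: U 1), (h @: U (-1)); split.
  have := e_sign x xB; rewrite !inE (negPf ex_neq0) /=.
  move=> /orP[/eqP ex | /eqP ex] eqU.
    have xU : x \in U (-1) by rewrite inE xB ex.
    by have := h_notin (-1) 1 isT xU; rewrite eqU imset_f.
  have xU : x \in U 1 by rewrite inE xB ex.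
  by have := h_notin 1 (-1) isT xU; rewrite -eqU imset_f.
have sumU c : \sum_(z in h @: U c) v z =
    \sum_(y in B) (if e y == c then v (h y) else 0).
  rewrite big_imset; last exact: hU_inj.
  by rewrite -big_mkcondr; apply: eq_bigl => y; rewrite inE.
apply/eqP; rewrite eqz_mod_dvd !sumU -sumrB; move: dvd_m; congr (_ %| _)%Z.
apply: eq_bigr => y /e_sign; rewrite !inE => /or3P[] /eqP -> /=.
- by rewrite mulN1r add0r.
- by rewrite mul0r subrr.
- by rewrite mul1r subr0.
Qed.

(** The difference of the indicators of [S1] and [S2] is such an [e], and it vanishes only if the
    sets agree. *)
Lemma has_NAR_signs (S : finType) (v : S -> int) :
  (forall e : S -> int, (forall x, e x \in [:: -1; 0; 1]) ->
     \sum_x e x * v x = 0 -> forall x, e x = 0) -> ~ has_NAR v.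
Proof.
move=> noNAR [S1 [S2 [neqS eq_sum]]]; apply: neqS.
have e0 := noNAR (fun x => (x \in S1)%:R - (x \in S2)%:R).
apply/setP => x; apply/eqP.
suff : (x \in S1)%:R - (x \in S2)%:R == 0 :> int.
  by case: (x \in S1); case: (x \in S2).
apply/eqP; apply: e0 => [y|]; first by case: (y \in S1); case: (y \in S2).
under eq_bigr do rewrite mulrBl !mulr_natl !mulrb.
by rewrite sumrB -!big_mkcond eq_sum subrr.
Qed.

(** * Absence of relations on P(N) *)

Section Exponents.
Variables (I : finType) (n : I -> nat).
Local Notation exps := {dffun forall i : I, 'I_(n i).+1}.
Implicit Type m : exps.

Definition restr_exp (i : I) m :
    {dffun forall j : {j | j != i}, 'I_(n (val j)).+1} :=
  [ffun j => m (val j)].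

Lemma restr_exp_inj (i : I) (k : nat) :
  {in [set m : exps | m i == k :> nat] &, injective (restr_exp i)}.
Proof.
move=> m m'; rewrite !inE => /eqP mk /eqP m'k /ffunP eq_m; apply/ffunP => j.
have [->|j_neq] := eqVneq j i; first by apply: val_inj; rewrite /= mk m'k.
by have := eq_m (Sub j j_neq); rewrite !ffunE.
Qed.

Hypothesis n_gt0 : forall i, (0 < n i)%N.

Fact pred_exp_subproof i (k : 'I_(n i).+1) : (k.-1 < n i)%N.
Proof. by case: k => -[|k] lek //=; exact: n_gt0. Qed.

(** The shift matches (p_j - 1) p_j^(m_j - 1) with an entry of [powers]. Exponents 0 and 1 both go
    to 0, so injectivity needs positive exponents. *)
Definition pred_exp (i : I) m : {dffun forall j : {j | j != i}, 'I_(n (val j))} :=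
  [ffun j => Ordinal (pred_exp_subproof (m (val j)))].

Lemma pred_exp_inj (i : I) (k : nat) :
  {in [set m : exps | (m i == k :> nat) && [forall j, 0 < m j]%N] &,
   injective (pred_exp i)}.
Proof.
move=> m m'; rewrite !inE => /andP[/eqP mk /forallP m_gt0].
move=> /andP[/eqP m'k /forallP m'_gt0] /ffunP eq_m; apply/ffunP => j.
apply: val_inj => /=; have [->|j_neq] := eqVneq j i; first by rewrite mk m'k.
have := eq_m (Sub j j_neq); rewrite !ffunE => /(congr1 val) /= eq_pred.
by rewrite -(prednK (m_gt0 j)) eq_pred prednK.
Qed.

Variable p : I -> nat.
Hypotheses (p_inj : injective p) (p_pr : forall i, prime (p i)).

Lemma P_family_restr (i : I) m : m i = 0 :> nat ->
  P_family p m = P_family (fun j => p (val j)) (restr_exp i m).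
Proof.
move=> mi0; rewrite /P_family; congr (totient _)%:Z.
rewrite (bigD1 i) //= mi0 mul1n.
rewrite (big_sub (fun j => j != i) (fun j => (p j ^ m j)%N)).
by apply: eq_bigr => j _; rewrite ffunE.
Qed.

Lemma P_family_dvd (i : I) m : m i != 0 :> nat -> ((p i)%:Z - 1 %| P_family p m)%Z.
Proof.
move=> /negPf mi; rewrite P_family_tensor // /tensor (bigD1 i) //=.
by rewrite /totient_powers mi -mulrA dvdz_mulr.
Qed.

(** For positive exponents this is the totient divided by the product of the p_j - 1. The values at
    other vectors are harmless, their coefficients being 0. *)
Let w m : int := \prod_j (p j)%:Z ^+ (m j).-1.

Lemma P_family_pos m : [forall j, 0 < m j]%N ->
  P_family p m = \prod_j ((p j)%:Z - 1) * w m.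
Proof.
move=> /forallP m_gt0; rewrite P_family_tensor // /tensor -big_split /=.
by apply: eq_bigr => j _; rewrite /totient_powers gtn_eqF.
Qed.

Lemma prod_powers_pred (i : I) m :
  w m = (p i)%:Z ^+ (m i).-1 *
        tensor (fun j : {j | j != i} => @powers (p (val j)) (n (val j)))
               (pred_exp i m).
Proof.
rewrite /w (bigD1 i) //=; congr (_ * _).
rewrite (big_sub (fun j => j != i) (fun j => (p j)%:Z ^+ (m j).-1)).
by apply: eq_bigr => j _; rewrite /powers ffunE -!natz natrX.
Qed.

Lemma no_NAR_P_family :
  (forall i : I, ~ has_NAR_mod ((p i)%:Z - 1)
     (@P_family {j : I | j != i} (fun j => p (val j)) (fun j => n (val j)))) ->
  (exists i : I, ~ has_NAR_mod (p i)%:Z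
     (tensor (fun j : {j : I | j != i} => @powers (p (val j)) (n (val j))))) ->
  ~ has_NAR (@P_family I p n).
Proof.
move=> noNAR_P [i noNAR_i]; apply: has_NAR_signs => e e_sign sum0.
have e0 j m : m j = 0 :> nat -> e m = 0.
  move=> mj0; pose B := [set m : exps | m j == 0 :> nat].
  apply: (sign_coef_eq0 (noNAR_P j) (@restr_exp_inj j 0) (e := e)) => //;
    last by rewrite inE mj0.
  (* As the whole sum is 0, the part over [B] is minus the rest, whose terms are all multiples of
     p_j - 1. *)
  have -> : \sum_(m in B) e m * P_family (fun j => p (val j)) (restr_exp j m)
          = - \sum_(m | m \notin B) e m * P_family p m.
    apply/eqP; rewrite -addr_eq0; apply/eqP; rewrite -[RHS]sum0.
    rewrite [RHS](bigID (mem B)) /=; congr (_ + _); apply: eq_bigr => m'.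
    by rewrite inE => /eqP/P_family_restr ->.
  rewrite rpredN; apply: dvdz_sum => m'; rewrite inE => m'j.
  by rewrite dvdz_mull // P_family_dvd.
have {}sum0 : \sum_m e m * w m = 0.
  have /mulfI : \prod_j ((p j)%:Z - 1) != 0.
    apply/prodf_neq0 => j _; rewrite subr_eq0 eqz_nat.
    by rewrite gtn_eqF // prime_gt1.
  apply; rewrite mulr0 -[RHS]sum0 mulr_sumr; apply: eq_bigr => m _.
  have [m_gt0|] := boolP [forall j, 0 < m j]%N.
    by rewrite P_family_pos // mulrCA.
  rewrite negb_forall => /existsP[j]; rewrite -eqn0Ngt => /eqP/e0 ->.
  by rewrite !mul0r mulr0.
suff e0i k m : (m i <= k)%N -> e m = 0 by move=> m; exact: e0i (leqnn _).
elim: k m => [|k IHk] m; first by rewrite leqn0 => /eqP /e0.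
rewrite leq_eqVlt => /predU1P[mik|]; last exact: IHk.
have [m_gt0|] := boolP [forall j, 0 < m j]%N; last first.
  by rewrite negb_forall => /existsP[j]; rewrite -eqn0Ngt => /eqP/e0 ->.
pose B := [set m : exps | (m i == k.+1 :> nat) && [forall j, 0 < m j]%N].
apply: (sign_coef_eq0 noNAR_i (@pred_exp_inj i k.+1) (e := e)) => //;
  last by rewrite inE mik eqxx.
have pk_neq0 : (p i)%:Z ^+ k != 0 by rewrite expf_neq0 // eqz_nat -lt0n prime_gt0.
(* Multiplying by p_i^k turns the sum into the part over [B] of the relation [sum0], to be shown
   divisible by p_i^(k+1). *)
rewrite -(dvdz_mul2l pk_neq0) -exprSr mulr_sumr.
set s := \sum_(_ in _) _.
have -> : s = - \sum_(m' | m' \notin B) e m' * w m'.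
  apply/eqP; rewrite -addr_eq0; apply/eqP; rewrite -[RHS]sum0.
  rewrite [RHS](bigID (mem B)) /=; congr (_ + _); apply: eq_bigr => m'.
  by rewrite inE => /andP[/eqP m'i _]; rewrite (prod_powers_pred i) m'i mulrCA.
rewrite rpredN; apply: dvdz_sum => m'; rewrite inE negb_and.
(* Outside [B], the coefficient is 0 by induction if m'_i <= k, and by [e0] if m'_i = k + 1, some
   exponent being 0. If m'_i > k + 1, then p_i^(k+1) divides [w m']. *)
have [/IHk->|] := leqP (m' i) k; first by rewrite mul0r dvdz0.
rewrite leq_eqVlt eq_sym => /predU1P[->|].
  rewrite eqxx /= negb_forall => /existsP[j]; rewrite -eqn0Ngt => /eqP/e0 ->.
  by rewrite mul0r dvdz0.
move=> lt_k _; rewrite dvdz_mull // (prod_powers_pred i) dvdz_mulr //.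
by rewrite dvdz_exp2l // -ltnS prednK // (leq_trans _ lt_k).
Qed.
End Exponents.

(** * Spectra and degrees of regular graphs *)

Lemma spectrum_eigenvalue (n : nat) (e e' : rel 'I_n) :
  spectrum e = spectrum e' ->
  eigenvalue (adjacency e) =1 eigenvalue (adjacency e').
Proof.
rewrite /spectrum => /eq_seq_msetP; do 2 case: closed_field_poly_normal => /=.
move=> s' char' s char eq_ss' x; rewrite !eigenvalue_root_char char char'.
do 2 rewrite rootZ ?(monicP (char_poly_monic _)) ?oner_eq0 //.
by rewrite !root_prod_XsubC (perm_mem eq_ss').
Qed.

(** The all-ones vector is an eigenvector. Symmetry turns the column sums met by row eigenvectors
    into degrees. *)
Lemma eigenvalue_degree (n k : nat) (e : rel 'I_n) :
  (0 < n)%N -> symmetric e -> (forall i, #|e i| = k) ->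
  eigenvalue (adjacency e) k%:R.
Proof.
move=> n_gt0 e_sym e_reg; apply/eigenvalueP; exists (const_mx 1); last first.
  apply/eqP => /matrixP /(_ 0 (Ordinal n_gt0)) /eqP.
  by rewrite !mxE oner_eq0.
apply/matrixP => i j; rewrite !mxE mulr1 -(e_reg j) -sum1_card natr_sum.
rewrite [RHS]big_mkcond; apply: eq_bigr => l _.
by rewrite !mxE mul1r e_sym -topredE /=; case: (e j l).
Qed.

(* Read the eigenvector equation at a coordinate of maximal modulus. *)
Lemma eigenvalue_le_degree (n k : nat) (e : rel 'I_n) (x : algC) :
  symmetric e -> (forall i, #|e i| = k) -> eigenvalue (adjacency e) x ->
  `|x| <= k%:R.
Proof.
move=> e_sym e_reg /eigenvalueP[v /matrixP v_eig v_neq0].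
have /rV0Pn[i0 v0_neq0] := v_neq0.
have norm_real : {in xpredT, forall j, `|v 0 j| \is Num.real}.
  by move=> j _; exact: normr_real.
have [i _ v_max] := real_arg_maxP (isT : xpredT i0) norm_real.
have vi_gt0 : 0 < `|v 0 i| by apply: lt_le_trans (v_max i0 isT); rewrite normr_gt0.
rewrite -(ler_pM2r vi_gt0) -normrM; have := v_eig 0 i; rewrite !mxE => <-.
apply: le_trans (ler_norm_sum _ _ _) _.
rewrite -(e_reg i) -sum1_card natr_sum mulr_suml [leRHS]big_mkcond.
apply: ler_sum => j _; rewrite !mxE e_sym -topredE /=.
by case: (e i j); rewrite ?mulr1 ?mul1r ?mulr0 ?normr0 //; exact: v_max.
Qed.

(** Each degree is an eigenvalue of the other graph, hence at most the other degree. *)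
Lemma spectrum_degree (n k k' : nat) (e e' : rel 'I_n) :
  (0 < n)%N -> symmetric e -> symmetric e' ->
  (forall i, #|e i| = k) -> (forall i, #|e' i| = k') ->
  spectrum e = spectrum e' -> k = k'.
Proof.
move=> n_gt0 e_sym e'_sym e_reg e'_reg /spectrum_eigenvalue eq_eig.
have ev := eigenvalue_degree n_gt0 e_sym e_reg.
have ev' := eigenvalue_degree n_gt0 e'_sym e'_reg.
rewrite eq_eig in ev; rewrite -eq_eig in ev'.
have := eigenvalue_le_degree e'_sym e'_reg ev.
have := eigenvalue_le_degree e_sym e_reg ev'.
by rewrite !normr_nat !ler_nat => le_k'k le_kk'; apply/eqP; rewrite eqn_leq le_kk'.
Qed.

(** * Degrees of integral circulant graphs *)

Lemma card_gcdn (N d : nat) : (0 < N)%N -> (d %| N)%N ->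
  #|[pred k : 'I_N | gcdn k N == d]| = totient (N %/ d).
Proof.
move=> N_gt0 /dvdnP[M def_N]; rewrite def_N; move: N_gt0; rewrite def_N muln_gt0.
case/andP=> [M_gt0 d_gt0].
rewrite mulnK // totient_count_coprime big_mkord.
have h_lt (k : 'I_M) : (k * d < M * d)%N by rewrite ltn_pmul2r.
(* Multiplication by [d] maps the residues coprime to [M] bijectively onto those whose gcd with
   [M * d] is [d]. *)
pose h (k : 'I_M) : 'I_(M * d) := Ordinal (h_lt k).
have h_inj : injective h.
  move=> k k' /(congr1 val) /= /eqP.
  by rewrite eqn_pmul2r // => /eqP /val_inj.
under eq_bigr => k _ do rewrite coprime_sym.
have -> : (\sum_(k < M) coprime k M = #|[set k : 'I_M | coprime k M]|)%N.
  rewrite -sum1_card [RHS]big_mkcond; apply: eq_bigr => k _.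
  by rewrite inE; case: coprime.
rewrite -(card_imset _ h_inj); apply: eq_card => k; rewrite !inE.
apply/eqP/imsetP => [gcd_k|[l]].
  have /dvdnP[l def_k] : (d %| k)%N by have := dvdn_gcdl k (M * d); rewrite gcd_k.
  have l_lt : (l < M)%N by rewrite -(ltn_pmul2r d_gt0) -def_k ltn_ord.
  exists (Ordinal l_lt); last exact: val_inj.
  rewrite inE /coprime /= -(eqn_pmul2r d_gt0) mul1n muln_gcdl -def_k.
  by rewrite gcd_k.
by rewrite inE /coprime => /eqP co_l ->; rewrite /= -muln_gcdl co_l mul1n.
Qed.

(** The right-hand subtraction is modular: up to sign, it differs from the integer one by 0 or the
    modulus. *)
Lemma gcdn_distn (N : nat) (i j : 'I_N.+1) :
  gcdn `|(i : nat)%:Z - (j : nat)%:Z|%N N.+1 = gcdn (i - j)%R N.+1.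
Proof.
have le_jN : (j <= N.+1)%N by exact: ltnW.
rewrite /= modnDmr gcdn_modl addnBA //; case: (leqP j i) => [le_ji|lt_ij].
  by rewrite distnEl // -addnBAC // [RHS]gcdnC gcdnDr gcdnC.
have le_ij := ltnW lt_ij; have le_jiN := leq_trans (leq_subr i j) le_jN.
rewrite distnEr // addnC -subnBA //.
rewrite -[X in gcdn _ X = _](subnK le_jiN) gcdnDr gcdnC.
by rewrite -[X in _ = gcdn _ X](subnK le_jiN) gcdnDl.
Qed.

Lemma ICG_sym (N : nat) (D : {fset nat}) : symmetric (@ICG N D).
Proof. by move=> i j; rewrite /ICG distnC. Qed.

(** The involution sending j to i - j exchanges the neighbours of [i] with the residues counted on
    the right. *)
Lemma ICG_degree (N : nat) (D : {fset nat}) (i : 'I_N) :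
  #|@ICG N D i| = #|[pred k : 'I_N | gcdn k N \in D]|.
Proof.
case: N i => [[]//|N] i.
have subK : involutive (fun j : 'I_N.+1 => i - j) by move=> j; rewrite subKr.
rewrite -(card_image (inv_inj subK)); apply: eq_card => k.
rewrite -{1}(subK k) (mem_image (inv_inj subK)) inE -topredE /=.
by rewrite /ICG gcdn_distn subKr.
Qed.

Lemma divn_coK (M d : nat) : (0 < M)%N -> (d %| M)%N -> (M %/ (M %/ d) = d)%N.
Proof.
move=> M_gt0 dvd_d; rewrite -{1}(divnK dvd_d) mulKn // divn_gt0.
  exact: dvdn_leq.
exact: dvdn_gt0 dvd_d.
Qed.

Lemma dvdn_co (M d : nat) : (d %| M)%N -> (M %/ d %| M)%N.
Proof. by move=> dvd_d; rewrite -{2}(divnK dvd_d) dvdn_mulr. Qed.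

(** * Divisors of N as exponent vectors, and the ISAP *)

Section PrimeExponents.
Variables (I : finType) (p n : I -> nat).
Hypotheses (p_inj : injective p) (p_pr : forall i, prime (p i)).
Local Notation exps := {dffun forall i : I, 'I_(n i).+1}.
Implicit Type m : exps.
Let N := (\prod_i p i ^ n i)%N.

Lemma prod_primes_gt0 (f : I -> nat) : (0 < \prod_i p i ^ f i)%N.
Proof. by apply: prodn_gt0 => i; rewrite expn_gt0 prime_gt0. Qed.

Lemma logn_prod_primes (q : nat) (f : I -> nat) :
  logn q (\prod_i p i ^ f i) = (\sum_i f i * (q == p i))%N.
Proof.
elim/big_ind2: _ (prod_primes_gt0 f) => [|a b a' b' IHa IHb|i _] .
- by rewrite logn1.
- by rewrite muln_gt0 => /andP[a_gt0 b_gt0]; rewrite lognM // IHa ?IHb.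
- by rewrite lognX logn_prime.
Qed.

Lemma logn_prod_primesE (i : I) (f : I -> nat) :
  logn (p i) (\prod_i p i ^ f i) = f i.
Proof.
rewrite logn_prod_primes (bigD1 i) //= eqxx muln1 big1 ?addn0 // => j j_neq.
by rewrite (inj_eq p_inj) eq_sym (negPf j_neq) muln0.
Qed.

(** For [d] dividing [N], each valuation is at most [n i], so [inord] keeps it; a larger one would
    become 0. *)
Definition factor_exp (d : nat) : exps := [ffun i => inord (logn (p i) d)].

Lemma prod_factor_exp (d : nat) : (d %| N)%N ->
  (\prod_i p i ^ factor_exp d i)%N = d.
Proof.
move=> dvd_dN; have N_gt0 := prod_primes_gt0 n.
have d_gt0 := dvdn_gt0 N_gt0 dvd_dN.
have le_log q := dvdn_leq_log q N_gt0 dvd_dN.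
have factorE i : factor_exp d i = logn (p i) d :> nat.
  by rewrite ffunE inordK // ltnS (leq_trans (le_log _)) // logn_prod_primesE.
apply: eqn_from_log (prod_primes_gt0 _) d_gt0 _ => q.
have [i /eqP->|no_i] := pickP (fun i => q == p i).
  by rewrite (logn_prod_primesE i (fun i => factor_exp d i)).
(* When [q] is none of the [p i], both valuations are 0, that of [d] being bounded by that of
   [N]. *)
apply/eqP; rewrite (logn_prod_primes q (fun i => factor_exp d i)).
rewrite big1 => [|i _]; last first.
  by rewrite no_i muln0.
rewrite eq_sym -leqn0 (leq_trans (le_log q)) // logn_prod_primes big1 // => i _.
by rewrite no_i muln0.
Qed.

Lemma prod_primes_factorK m : factor_exp (\prod_i p i ^ m i) = m.
Proof.
by apply/ffunP => i; apply: val_inj; rewrite ffunE logn_prod_primesE inord_val.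
Qed.

Lemma prod_primes_dvd m : (\prod_i p i ^ m i %| N)%N.
Proof.
rewrite /N; elim/big_ind2: _ => // [a b a' b'|i _]; first exact: dvdn_mul.
by rewrite dvdn_exp2l // -ltnS.
Qed.

(** Residues [k] are grouped by the exponents of N / gcd(k, N). The class of gcd d has phi(N/d)
    elements, so indexing by N/d makes the degree a subsum of P(N). *)
Lemma ICG_degree_totient (D : {fset nat}) (i : 'I_N) :
  #|@ICG N D i| =
  (\sum_(m : exps | N %/ \prod_i p i ^ m i \in D) totient (\prod_i p i ^ m i))%N.
Proof.
have N_gt0 : (0 < N)%N := prod_primes_gt0 n.
rewrite ICG_degree -sum1_card.
pose mu (k : 'I_N) := factor_exp (N %/ gcdn k N).
have prod_mu k : (\prod_i p i ^ mu k i = N %/ gcdn k N)%N.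
  by rewrite prod_factor_exp ?dvdn_co ?dvdn_gcdr.
rewrite (partition_big mu (fun m => N %/ \prod_i p i ^ m i \in D)%N);
  last first => [k|].
  by rewrite prod_mu inE divn_coK ?dvdn_gcdr.
apply: eq_bigr => m mD.
rewrite -{1}(divn_coK N_gt0 (prod_primes_dvd m)).
rewrite -card_gcdn ?dvdn_co ?prod_primes_dvd //.
rewrite -sum1_card /=; apply: eq_bigl => k; rewrite !inE.
apply/andP/eqP => [[_ /eqP <-]|gcd_k]; first by rewrite prod_mu divn_coK ?dvdn_gcdr.
rewrite gcd_k mD /mu gcd_k divn_coK ?prod_primes_dvd //.
by rewrite prod_primes_factorK.
Qed.

Lemma ISAP_of_no_NAR : ~ has_NAR (@P_family I p n) -> ISAP N.
Proof.
move=> noNAR D D' symD symD'; split=> [eq_spec|-> //].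
have N_gt0 : (0 < N)%N := prod_primes_gt0 n.
pose U (E : {fset nat}) := [set m : exps | N %/ \prod_i p i ^ m i \in E]%N.
have sumU E : \sum_(m in U E) P_family p m =
    (\sum_(m : exps | N %/ \prod_i p i ^ m i \in E)
       totient (\prod_i p i ^ m i))%N%:Z.
  rewrite (big_morph Posz PoszD (erefl _)); apply: eq_bigl => m.
  by rewrite inE.
(* Equal spectra force equal degrees, so distinct index sets would form a NAR. *)
have eqU : U D = U D'.
  have [//|neqU] := eqVneq (U D) (U D'); case: noNAR; exists (U D), (U D').
  split; first exact/eqP.
  rewrite !sumU; congr Posz.
  exact: spectrum_degree N_gt0 (@ICG_sym N D) (@ICG_sym N D')
    (ICG_degree_totient D) (ICG_degree_totient D') eq_spec.
(* On divisors of [N], d -> N/d is an involution, so [U E] determines which of them lie in [E]; a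
   symbol contains only divisors. *)
have memU E d : (d %| N)%N -> (d \in E) = (factor_exp (N %/ d) \in U E).
  by move=> dvd_d; rewrite inE prod_factor_exp ?dvdn_co // divn_coK.
apply/fsetP => d; have [dvd_d|ndvd_d] := boolP (d %| N)%N.
  by rewrite !memU // eqU.
by apply/idP/idP => [/symD|/symD'] [dvd_d]; rewrite dvd_d in ndvd_d.
Qed.
End PrimeExponents.

Theorem theorem5p1 (N r : nat) (p n : 'I_r -> nat)
    (p_inj : injective p) (p_prime : forall i, prime (p i))
    (n_ge1 : forall i, (1 <= n i)%N)
    (N_def : N = (\prod_(i < r) p i ^ n i)%N)
    (noNAR_P : forall i : 'I_r,
      ~ has_NAR_mod ((p i)%:Z - 1)
          (@P_family {j : 'I_r | j != i}
             (fun j => p (val j)) (fun j => n (val j))))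
    (noNAR_powers : exists i : 'I_r,
      ~ has_NAR_mod (p i)%:Z
          (tensor (fun j : {j : 'I_r | j != i} =>
             @powers (p (val j)) (n (val j))))) :
  ~ has_NAR (@P_family 'I_r p n) /\ ISAP N.
Proof.
have noNAR := no_NAR_P_family n_ge1 p_inj p_prime noNAR_P noNAR_powers.
by split=> //; rewrite N_def; apply: ISAP_of_no_NAR.
Qed.
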